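(* There does not exist a semi-equivelar toroidal map of type $[4^1,6^1,12^1]$ which is $5$-orbital, i.e., there is no semi-equivelar map $X$ on the torus of type $[4^1,6^1,12^1]$ whose vertex set $V(X)$ splits into exactly $5$ orbits under the action of the automorphism group ${\rm Aut}(X)$.
   Context: All maps are polyhedral maps on surfaces: each face is an $n$-gon for some $n\ge 3$, and any two faces intersect in the empty set, a single vertex, or a single edge. For a vertex $u$ of a map $X$, the faces containing $u$ form a cycle $C_u$ in the dual graph (the face-cycle at $u$). $X$ is semi-equivelar of type $[p_1^{n_1},\dots,p_k^{n_k}]$ if for every vertex $u$ the face-cycle $C_u$ consists, in cyclic order, of $n_1$ consecutive $p_1$-gons, then $n_2$ consecutive $p_2$-gons, ..., then $n_k$ consecutive $p_k$-gons (with $p_i\ne p_{i+1}$ cyclically); types are identified up to cyclic shift and reversal. Thus type $[4^1,6^1,12^1]$ means each vertex lies in exactly one square, one hexagon and one $12$-gon. A toroidal map is a map whose underlying surface is the torus. A map $X$ is called $m$-orbital if $V(X)$ forms exactly $m$ orbits under ${\rm Aut}(X)$. *)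

(* Defs.v *)
From HB Require Import structures.
From mathcomp Require Import all_boot all_order all_algebra all_fingroup.

Set Implicit Arguments.
Unset Strict Implicit.
Unset Printing Implicit Defensive.

(** Maps on closed surfaces are treated combinatorially: a map is
    given by its finitely many vertices and faces, together with the boundary
    polygon of each face, listed in one of its cyclic orders.  The starting
    point and the direction of the list carry no information: see
    [same_polygon].  In a polyhedral map an edge is determined by its two end
    points, so edges are two-element sets of vertices. *)

Record face_complex := FaceComplex {
  vert : finType;
  face : finType;
  bd : face -> seq vert
}.

Section FaceComplex.
Variable X : face_complex.
Implicit Types (u v : vert X) (f g : face X) (c : seq (face X)).

Definition face_verts f : {set vert X} := [set v in bd f].

Definition face_edges f : {set {set vert X}} :=
  [set [set v; next (bd f) v] | v in bd f].

Definition edges : {set {set vert X}} := \bigcup_(f : face X) face_edges f.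

Definition adjacent u v : bool := [set u; v] \in edges.

(* Adjacency in the dual graph. *)
Definition dual_adjacent f g : bool :=
  (f != g) && (face_edges f :&: face_edges g != set0).

Definition is_face_cycle u c : Prop :=
  [/\ c != [::], uniq c, path.cycle dual_adjacent c &
      forall f, (f \in c) = (u \in bd f)].

Definition meet_properly f g : Prop :=
  let I := face_verts f :&: face_verts g in
  [\/ I = set0,
      exists v, I = [set v]
    | exists2 e, e \in face_edges f :&: face_edges g & I = e].

(* The conditions [edge_two_faces] and [has_face_cycle] together say that the
   link of every vertex is a single cycle, that is, that the underlying space
   is a closed 2-manifold. *)
Record is_polyhedral_map : Prop := IsPolyhedralMap {
  bd_uniq : forall f, uniq (bd f);
  bd_size : forall f, 3 <= size (bd f);
  faces_meet : forall f g, f != g -> meet_properly f g;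
  edge_two_faces : forall e, e \in edges -> #|[set f | e \in face_edges f]| = 2;
  has_face_cycle : forall u, exists c, is_face_cycle u c;
  vert_nonempty : 0 < #|vert X|;
  vert_connected : forall u v, connect adjacent u v
}.

Definition euler_char : int :=
  (#|vert X|%:Z - #|edges|%:Z + #|face X|%:Z)%R.

(* [o] chooses one of the two directions of each boundary polygon. *)
Definition oriented_bd (o : face X -> bool) f : seq (vert X) :=
  if o f then bd f else rev (bd f).

(* Faces can be oriented so that the two faces at any edge induce opposite
   directions on it: no directed edge is traversed by two distinct faces. *)
Definition orientable : Prop :=
  exists o : face X -> bool, forall f g v,
    v \in bd f -> v \in bd g ->
    next (oriented_bd o f) v = next (oriented_bd o g) v -> f = g.

(* By the classification of closed surfaces, the torus is the connected
   orientable closed surface of Euler characteristic 0. *)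
Definition toroidal : Prop := orientable /\ euler_char = 0%R.

(* A type [p_1^n_1, ..., p_k^n_k] is given by the list of the (p_i, n_i). *)
Definition type_word (t : seq (nat * nat)) : seq nat :=
  flatten [seq nseq pn.2 pn.1 | pn <- t].

(* Any rotation or reversal of a face-cycle is again one, so the choice of [c]
   accounts for types being taken up to cyclic shift and reversal. *)
Definition semi_equivelar (t : seq (nat * nat)) : Prop :=
  forall u, exists2 c, is_face_cycle u c &
    [seq size (bd f) | f <- c] = type_word t.

(* Equality of polygons: same list up to rotation and reversal. *)
Definition same_polygon (s t : seq (vert X)) : bool :=
  [exists i : 'I_(size s).+1, (t == rot i s) || (t == rot i (rev s))].

(* Automorphisms, orientation-reversing ones included: the permutations of the
   vertices taking faces to faces, hence edges to edges. *)
Definition Aut_map : {set {perm vert X}} :=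
  [set s : {perm vert X} |
    [forall f, [exists g, same_polygon (map s (bd f)) (bd g)]]].

Lemma same_polygonP (s t : seq (vert X)) :
  reflect (exists i, t = rot i s \/ t = rot i (rev s)) (same_polygon s t).
Proof.
apply: (iffP existsP) => [[i /orP[]/eqP->]|[i]]; first by exists i; left.
  by exists i; right.
have hi : minn i (size s) < (size s).+1 by rewrite ltnS geq_minr.
have rotm (r : seq (vert X)) : size r = size s ->
    rot i r = rot (minn i (size s)) r.
  move=> <-; have [//|/ltnW le_ri] := leqP i (size r).
  by rewrite rot_size rot_oversize.
case=> ->; exists (Ordinal hi) => /=; first by rewrite rotm ?eqxx.
by rewrite [X in X == rot _ (rev s)]rotm ?size_rev ?eqxx ?orbT.
Qed.

Lemma same_polygon_map (h : {perm vert X}) (s t : seq (vert X)) :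
  same_polygon s t -> same_polygon (map h s) (map h t).
Proof.
case/same_polygonP=> i [] ->; apply/same_polygonP; exists i.
  by left; rewrite map_rot.
by right; rewrite map_rot map_rev.
Qed.

Lemma same_polygon_trans (r s t : seq (vert X)) :
  same_polygon r s -> same_polygon s t -> same_polygon r t.
Proof.
have rr i j (q : seq (vert X)) : exists k, rot i (rot j q) = rot k q.
  have [le_i|/ltnW lt_i] := leqP i (size q); last first.
    by exists j; rewrite rot_oversize ?size_rot.
  have [le_j|/ltnW lt_j] := leqP j (size q); last first.
    by exists i; rewrite (rot_oversize lt_j).
  by rewrite rot_add_mod //; eexists.
have rv i (q : seq (vert X)) : exists k, rev (rot i q) = rot k (rev q).
  rewrite rev_rot /rotr; by eexists.
case/same_polygonP=> i [] -> /same_polygonP[j [] ->]; apply/same_polygonP.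
- by have [k ->] := rr j i r; exists k; left.
- by have [k ->] := rv i r; have [l ->] := rr j k (rev r); exists l; right.
- by have [k ->] := rr j i (rev r); exists k; right.
- have [k ->] := rv i (rev r); rewrite revK.
  by have [l ->] := rr j k r; exists l; left.
Qed.

Lemma Aut_map_group_set : group_set Aut_map.
Proof.
apply/group_setP; split=> [|s t].
  rewrite inE; apply/forallP=> f; apply/existsP; exists f.
  by apply/same_polygonP; exists 0; left; rewrite rot0 (eq_map (@perm1 _)) map_id.
rewrite !inE => /forallP hs /forallP ht.
apply/forallP=> f; have /existsP[g fg] := hs f; have /existsP[h gh] := ht g.
apply/existsP; exists h; rewrite (eq_map (permM s t)) (map_comp t s).
exact: same_polygon_trans (same_polygon_map t fg) gh.
Qed.

Canonical Aut_map_group := Group Aut_map_group_set.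

Definition m_orbital (m : nat) : Prop :=
  #|[set orbit 'P Aut_map u | u : vert X]| = m.

End FaceComplex.

Record polyhedral_map := PolyhedralMap {
  complex_of :> face_complex;
  polyhedral_mapP : is_polyhedral_map complex_of
}.

(* Main.v *)
Require Import Defs.
From mathcomp Require Import all_boot all_order all_algebra all_fingroup.
From mathcomp Require Import cyclic.

(** At every vertex the three edges are told apart by the two faces at them, so
    moving along them defines involutions a (edge between square and 12-gon),
    b (square and hexagon) and c (hexagon and 12-gon) of V(X), with
    (ab)^2 = (bc)^3 = (ac)^6 = 1.  They generate a transitive quotient P of the
    symmetry group of the plane tiling 4.6.12, in which the translations form
    an abelian normal subgroup T with P = T <a, c>, so that |P : T| divides 12.
    A vertex stabilizer lies in T: orientability excludes the elements of odd
    length, and an even element outside T has a power conjugate to a rotation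
    about a face, which has no fixed vertex because the faces are honest
    polygons.  Finally Aut(X) is the centralizer of P in Sym(V(X)), so that its
    orbits are the classes of vertices with equal stabilizers in P; there are
    |P : N_P(P_v)| of them, and N_P(P_v) contains T because T is abelian.
    Hence the number of orbits divides 12. *)

Set Implicit Arguments.
Unset Strict Implicit.
Unset Printing Implicit Defensive.
Import GroupScope.

(** Powers of [p] are collected on the left. With [p] a rotation and [g] a translation, a relation
    on [p * g] thus becomes one among conjugates of [g]; cubes are treated likewise below. *)
Lemma expMg2_conj (gT : finGroupType) (p g : gT) :
  (p * g) ^+ 2 = p ^+ 2 * (g ^ p * g).
Proof. by rewrite conjgE !expgS expg0 !mulg1 !mulgA mulgK. Qed.

Lemma expMg3_conj (gT : finGroupType) (p g : gT) :
  (p * g) ^+ 3 = p ^+ 3 * (g ^ (p ^+ 2) * (g ^ p * g)).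
Proof.
rewrite -[p ^+ 2]/(p * p) -[p ^+ 3]/(p * (p * p)).
by rewrite -[LHS]/(p * g * (p * g * (p * g))) !conjgE invMg !mulgA !mulgK.
Qed.

(** * Permutations without fixed points *)

Section FixedPointFree.
Variable V : finType.
Implicit Types g s : {perm V}.

Definition fpfree g : bool := [forall v, g v != v].

Lemma fpfreeJ g s : fpfree (g ^ s) = fpfree g.
Proof.
suff imp h k : fpfree h -> fpfree (h ^ k).
  by apply/idP/idP=> [/(imp _ s^-1)|/imp//]; rewrite conjgK.
move=> /forallP fh; apply/forallP=> v; rewrite -(permKV k v) permJ.
by rewrite (inj_eq perm_inj) fh.
Qed.

Lemma fpfreeV g : fpfree g^-1 = fpfree g.
Proof.
suff imp h : fpfree h -> fpfree h^-1 by apply/idP/idP=> /imp; rewrite ?invgK.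
move=> /forallP fh; apply/forallP=> v; apply/eqP=> hv; have := fh v.
by rewrite -{1}hv permKV eqxx.
Qed.

End FixedPointFree.

(** * The translation lattice and its index *)

Section TriangleGroup.
Variables (V : finType) (a b c : {perm V}).
Hypotheses (a2 : a * a = 1) (b2 : b * b = 1) (c2 : c * c = 1).
Hypotheses (ab2 : (a * b) ^+ 2 = 1) (bc3 : (b * c) ^+ 3 = 1).
Hypothesis ac6 : (a * c) ^+ 6 = 1.

Let r : {perm V} := a * c.
(* A half-turn about a 12-gon followed by one about an adjacent square. *)
Let x : {perm V} := r ^+ 3 * (a * b).
(** In the plane, [y] is [x] turned by 120 degrees; together they generate a hexagonal lattice. *)
Let y : {perm V} := x ^ (r ^+ 2).

Definition translations : {group {perm V}} := (<[x]> <*> <[y]>)%G.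
Definition triangle_group : {group {perm V}} := <<[set a; b; c]>>%G.
Local Notation T := translations.
Local Notation P := triangle_group.

Let aV : a^-1 = a. Proof. by apply/eqP; rewrite eq_invg_mul a2. Qed.
Let bV : b^-1 = b. Proof. by apply/eqP; rewrite eq_invg_mul b2. Qed.
Let cV : c^-1 = c. Proof. by apply/eqP; rewrite eq_invg_mul c2. Qed.
Let r_mod6 i : r ^+ (6 + i) = r ^+ i.
Proof. by rewrite expgD ac6 mul1g. Qed.
Let r3V : (r ^+ 3)^-1 = r ^+ 3.
Proof. by apply/eqP; rewrite eq_invg_mul -expgD ac6. Qed.

Let abE : a * b = r ^+ 3 * x.
Proof. by rewrite /x mulgA -expgD ac6 mul1g. Qed.
Let abC : a * b = b * a.
Proof.
have: (a * b)^-1 = a * b by apply/eqP; rewrite eq_invg_mul; apply/eqP.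
by rewrite invMg aV bV.
Qed.

(** This is the relation [(a * b) ^+ 2 = 1] with [a * b] written as [r ^+ 3 * x]. *)
Let xr3 : x ^ (r ^+ 3) = x^-1.
Proof.
apply/eqP; rewrite eq_sym eq_invg_mul.
have := ab2; rewrite abE expMg2_conj -expgM ac6 mul1g => e.
by rewrite -(inj_eq (mulgI (x ^ (r ^+ 3)))) mulgA e mul1g mulg1.
Qed.
Let xr_add3 i : x ^ (r ^+ (i + 3)) = (x ^ (r ^+ i))^-1.
Proof. by rewrite addnC expgD conjgM xr3 conjVg. Qed.

Let bcE : b * c = r ^+ 4 * x ^ r.
Proof.
rewrite conjgE mulgA (expgD r 3 1) mulgK mulgA -abE abC /r.
by rewrite !mulgA -(mulgA b) a2 mulg1.
Qed.
(** This is the relation [(b * c) ^+ 3 = 1]. By [bcE], its collected factors are the conjugates of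
    [x] by [r ^+ 9], [r ^+ 5] and [r], that is [x^-1], [y^-1] and [x ^ r]. *)
Let rel3 : y * x = x ^ r.
Proof.
have := bc3; rewrite bcE expMg3_conj -!expgM -!conjgM (r_mod6 6) ac6 mul1g.
rewrite -!expgS (r_mod6 3) xr3 (xr_add3 2) -/y mulgA -invMg.
by move/(canRL (mulKVg _)); rewrite mulg1.
Qed.
(** Conjugation by [r ^+ 3] inverts [x], [y] and [x ^ r]; applied to [rel3] it yields the same
    product in the opposite order. *)
Let xyC : x * y = y * x.
Proof.
have y3 : y ^ (r ^+ 3) = y^-1 by rewrite -conjgM -expgD xr_add3.
have x1r3 : (x ^ r) ^ (r ^+ 3) = (x ^ r)^-1.
  by rewrite -conjgM -expgS (xr_add3 1).
by apply: invg_inj; rewrite invMg -xr3 -y3 -conjMg rel3 x1r3 -rel3.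
Qed.
Let xr : x ^ r = x * y. Proof. by rewrite xyC rel3. Qed.
Let yr : y ^ r = x^-1. Proof. by rewrite -conjgM -expgSr xr3. Qed.
Let raV : r ^ a = r^-1.
Proof. by rewrite conjgE aV /r !mulgA a2 mul1g invMg aV cV. Qed.
Let r2V : (r ^+ 2)^-1 = r ^+ (1 + 3).
Proof. by apply/eqP; rewrite eq_invg_mul -expgD ac6. Qed.
Let r3a : (r ^+ 3) ^ a = r ^+ 3.
Proof. by rewrite conjXg raV expgVn r3V. Qed.
Let xa : x ^ a = x.
Proof.
rewrite /x conjMg r3a conjMg !conjgE aV a2 mulg1 -abC.
by rewrite (mulgA a a) a2 mul1g.
Qed.
Let ya : y ^ a = (x * y)^-1.
Proof. by rewrite /y conjJg xa conjXg raV expgVn r2V xr_add3 expg1 xr. Qed.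

Let xT : x \in T. Proof. by rewrite mem_gen // inE cycle_id. Qed.
Let yT : y \in T. Proof. by rewrite mem_gen // inE cycle_id orbT. Qed.

Let cyx : <[y]> \subset 'C(<[x]>).
Proof.
by rewrite cent_cycle cycle_subG; apply/cent1P; rewrite /commute xyC.
Qed.

Let TE : T = <[x]> * <[y]> :> {set _}.
Proof. by rewrite /= cent_joinEr. Qed.

Let cTT : abelian T.
Proof. by rewrite abelianY !cycle_abelian. Qed.

Let TP t : t \in T -> exists i j, t = x ^+ i * y ^+ j.
Proof.
by rewrite TE => /mulsgP[_ _ /cycleP[i ->] /cycleP[j ->] ->]; exists i, j.
Qed.

Let nTP (g : {perm V}) : x ^ g \in T -> y ^ g \in T -> g \in 'N(T).
Proof.
by move=> xg yg; rewrite inE /= conjYg -!cycleJ join_subG !cycle_subG xg yg.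
Qed.

Let xyT : x * y \in T. Proof. exact: groupM xT yT. Qed.
Let rN : r \in 'N(T). Proof. by apply: nTP; rewrite ?xr ?yr ?groupV. Qed.
Let aN : a \in 'N(T). Proof. by apply: nTP; rewrite ?xa ?ya ?groupV. Qed.

(** The point group: a quotient of the dihedral group of order 12. *)
Let D : {group {perm V}} := (<[r]> <*> <[a]>)%G.

Let DE : D = <[r]> * <[a]> :> {set _}.
Proof.
by rewrite /= norm_joinEr // cycle_subG inE -cycleJ raV cycleV.
Qed.

Let nD : D \subset 'N(T). Proof. by rewrite join_subG !cycle_subG rN. Qed.

(** The missing generators are recovered as [b = a * (r ^+ 3 * x)] and [c = a * r]. *)
Let PE : P = T * D :> {set _}.
Proof.
have aP : a \in P by rewrite mem_gen // !inE eqxx.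
have bP : b \in P by rewrite mem_gen // !inE eqxx ?orbT.
have cP : c \in P by rewrite mem_gen // !inE eqxx ?orbT.
have rP : r \in P by apply: groupM.
have xP : x \in P by apply: groupM; [exact: groupX | exact: groupM].
have sTQ : T \subset T <*> D by apply: joing_subl.
have sDQ : D \subset T <*> D by apply: joing_subr.
have aQ : a \in T <*> D.
  by apply: (subsetP sDQ); rewrite mem_gen // inE cycle_id orbT.
have rQ : r \in T <*> D.
  by apply: (subsetP sDQ); rewrite mem_gen // inE cycle_id.
rewrite -norm_joinEr //; apply/eqP; rewrite eqEsubset; apply/andP; split.
  rewrite gen_subG; apply/subsetP=> g; rewrite !inE -!orbA => /or3P[]/eqP-> //.
    rewrite -(mulKg a b) aV abE; apply: groupM => //.
    by apply: groupM; [exact: groupX | rewrite (subsetP sTQ)].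
  by rewrite -(mulKg a c) aV; apply: groupM.
rewrite join_subG /= !join_subG !cycle_subG rP aP xP /= andbT.
by apply: groupJ => //; apply: groupX.
Qed.

Lemma translations_sub : T \subset P. Proof. by rewrite PE mulG_subl. Qed.

Lemma translations_abelian : abelian T. Proof. exact: cTT. Qed.

Lemma index_translations : #|P : T| %| 12.
Proof.
have : #|D| %| 12.
  apply: (@dvdn_trans (#|<[r]>| * #|<[a]>|)).
    by rewrite mul_cardG -DE dvdn_mulr.
  apply: (@dvdn_mul _ _ 6 2); rewrite order_dvdn; first by rewrite ac6.
  by apply/eqP.
apply: dvdn_trans.
by rewrite PE indexMg dvdn_indexg.
Qed.

(** * Rotations have no fixed vertex *)

Hypotheses (ab_free : fpfree (a * b)) (bc_free : fpfree (b * c)).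
Hypothesis ac2_free : fpfree ((a * c) ^+ 2).
Hypothesis ac3_free : fpfree ((a * c) ^+ 3).

(* Conjugating [t * g] by [s] only changes the translation part. *)
Let fpfree_shift g t s : t \in T -> s \in T ->
  fpfree (t * (s^-1 * s ^ g^-1) * g) = fpfree (t * g).
Proof.
move=> tT sT; rewrite -[RHS](fpfreeJ _ s) !conjgE invgK; congr fpfree.
by rewrite !mulgA mulgKV (centsP cTT t tT s^-1) ?groupV.
Qed.

Let mulT i j m n :
  x ^+ i * y ^+ j * (x ^+ m * y ^+ n) = x ^+ (i + m) * y ^+ (j + n).
Proof.
have cyj : commute (y ^+ j) (x ^+ m) by apply: commuteX2; rewrite /commute xyC.
by rewrite mulgA -(mulgA (x ^+ i)) cyj !expgD !mulgA.
Qed.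

Let rXJ m n : (r ^+ m) ^ (r ^+ n) = r ^+ m.
Proof. by rewrite conjgE -expgD addnC expgD mulKg. Qed.

(* The half-turns: modulo shifts by squares, [t] is 1, [x], [y] or [x * y].  For
   1 this is the half-turn about a 12-gon, otherwise about a square. *)
Let fpfree_half t : t \in T -> fpfree (t * r ^+ 3).
Proof.
case/TP=> i [j ->].
(* As [r ^+ 3] inverts [s], shifting by [s] removes a factor [s * s], which reduces both exponents
   modulo 2. *)
pose s := x ^+ (i %/ 2) * y ^+ (j %/ 2).
have sT : s \in T by apply: groupM; apply: groupX.
have tE : x ^+ i * y ^+ j = x ^+ (i %% 2) * y ^+ (j %% 2) * (s * s).
  by rewrite !mulT !addnn -!muln2 ![(_ %% _ + _)%N]addnC -!divn_eq.
have sr3 : s ^ (r ^+ 3) = s^-1.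
  rewrite conjMg !conjXg xr3 -conjgM -expgD xr_add3 !expgVn -invMg.
  by congr _^-1; apply: commuteX2; rewrite /commute xyC.
rewrite -(fpfree_shift _ _ sT); last by rewrite tE !groupM // groupX.
rewrite r3V sr3 tE -invMg mulgK.
have ab0 : fpfree (x * r ^+ 3).
  by rewrite -(fpfreeJ _ (r ^+ 3)^-1) conjgE invgK mulgK -abE.
(* Conjugation by [r] or [r ^+ 2] takes [x] to [x * y] or [y] and fixes [r ^+ 3], so both cases
   reduce to [ab0]. *)
rewrite !modn2; case: (odd i) (odd j) => [][]; rewrite ?expg1 ?mulg1 ?mul1g //.
  by rewrite -xr -[X in _ * X](rXJ 3 1) -conjMg fpfreeJ.
by rewrite -[X in _ * X](rXJ 3 2) -conjMg fpfreeJ.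
Qed.

(* The rotations of order 3: modulo shifts, [t] is 1, [x] or [x^-1].  For 1 this
   is a rotation about a 12-gon, otherwise about a hexagon. *)
Let fpfree_third t : t \in T -> fpfree (t * r ^+ 2).
Proof.
case/TP=> i [j ->].
have yr4 : y ^ (r ^+ (1 + 3)) = x.
  by rewrite -r2V conjgK.
have xr4 : x ^ (r ^+ (1 + 3)) = (x * y)^-1 by rewrite xr_add3 expg1 xr.
(* Shifting by [y ^+ n] trades this factor for [x ^+ n]. *)
have sY n : fpfree (x ^+ i * y ^+ n * r ^+ 2) = fpfree (x ^+ (i + n) * r ^+ 2).
  rewrite -(@fpfree_shift _ _ (y ^+ n)) ?groupM ?groupX //.
  by rewrite r2V conjXg yr4 !mulgA mulgK expgD.
rewrite {}sY; move: (i + j)%N => {j}i.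
(* The shift by this [s] multiplies by [x ^+ 3], so only the exponent of [x] modulo 3 matters. *)
pose s := y * x^-1.
have sT : s \in T by rewrite groupM // groupV.
have sE : s^-1 * s ^ (r ^+ (1 + 3)) = x ^+ 3.
  rewrite conjMg conjVg yr4 xr4 invgK invMg invgK -mulgA.
  by rewrite xyC (mulgA x y) xyC -(mulgA y) mulKg.
have red n m : fpfree (x ^+ (n + m * 3) * r ^+ 2) = fpfree (x ^+ n * r ^+ 2).
  elim: m => [|m <-]; first by rewrite addn0.
  rewrite -[RHS](fpfree_shift _ _ sT) ?groupX // r2V sE -expgD.
  by rewrite mulSnr addnA.
(* Shifting by [x] turns this element into [(b * c)^-1]. *)
have x1 : fpfree (x * r ^+ 2).
  rewrite -(fpfree_shift _ _ xT) // r2V xr4 mulKVg.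
  have := bc_free; rewrite bcE -fpfreeV invMg xr.
  by have -> : (r ^+ 4)^-1 = r ^+ 2 by rewrite -[4]/(1 + 3) -r2V invgK.
(* The residue 2 is represented by [x^-1 = y ^ r]; undoing the conjugation and shifting by [y] leads
   back to [x1]. *)
have x2 : fpfree (x^-1 * r ^+ 2).
  rewrite -yr -(rXJ 2 1) -conjMg fpfreeJ.
  by rewrite -(fpfree_shift _ _ yT) // r2V yr4 mulKVg.
rewrite (divn_eq i 3) addnC red; have := ltn_pmod i (isT : 0 < 3).
case: (i %% 3) => [|[|[|//]]] _; rewrite ?expg0 ?mul1g //.
by move: x2; rewrite -(fpfree_shift _ _ sT) ?groupV // r2V sE expgS mulKg.
Qed.

(** * Vertex stabilizers, given a two-colouring that every generator reverses *)

Variable eps : V -> bool.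
Hypotheses (epsa : forall v, eps (a v) = ~~ eps v).
Hypotheses (epsb : forall v, eps (b v) = ~~ eps v).
Hypotheses (epsc : forall v, eps (c v) = ~~ eps v).

Let even (g : {perm V}) := forall v, eps (g v) = eps v.
Let evenM g h : even g -> even h -> even (g * h).
Proof. by move=> eg eh v; rewrite permM eh eg. Qed.
Let evenX g n : even g -> even (g ^+ n).
Proof.
by move=> eg; elim: n => [|n IHn] v; rewrite ?expg0 ?perm1 // expgS evenM.
Qed.
Let evenr : even r. Proof. by move=> v; rewrite permM epsc epsa negbK. Qed.
Let evenx : even x.
Proof.
by apply: evenM; [exact: evenX | move=> v; rewrite permM epsb epsa negbK].
Qed.
Let evenJ g h : even g -> even h -> even (g ^ h).
Proof. by move=> eg eh v; rewrite -(permKV h v) permJ !eh eg. Qed.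
Let eveny : even y. Proof. by apply: evenJ => //; exact: evenX. Qed.

Lemma stabilizer_translations v : 'C_P[v | 'P] \subset T.
Proof.
apply/subsetP=> p /setIP[]; rewrite PE => /mulsgP[t d tT].
have rmod (n : nat) : r ^+ n = r ^+ (n %% 6).
  by rewrite {1}(divn_eq n 6) expgD mulnC expgM ac6 expg1n mul1g.
rewrite DE => /mulsgP[_ _ /cycleP[i ->] /cycleP[j ->] ->] -> /astab1P /=.
rewrite (rmod i); move: (i %% 6) (ltn_pmod i (isT : 0 < 6)) => {}i lt_i6.
rewrite apermE => fix_v.
have et : even t by have [m [n ->]] := TP tT; apply: evenM; exact: evenX.
have {fix_v} [aj fix_v] : a ^+ j = 1 /\ (t * r ^+ i) v = v.
  have ej (n : nat) w : eps ((a ^+ n) w) = odd n (+) eps w.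
    elim: n w => [|n IHn] w; first by rewrite expg0 perm1.
    by rewrite expgSr permM epsa IHn addNb.
  (* [t] and [r] preserve the colour whereas [a] reverses it, so an element fixing [v] contains an
     even power of [a]. *)
  have oddj : odd j = false.
    have := congr1 eps fix_v; rewrite mulgA permM ej evenM //;
      last exact: evenX.
    by case: (odd j) (eps v) => [][].
  have aj : a ^+ j = 1.
    rewrite -(odd_double_half j) oddj -muln2 mulnC expgM.
    by rewrite expgS expg1 a2 expg1n.
  by split=> //; rewrite aj mulg1 in fix_v.
rewrite aj mulg1.
have nfree (g : {perm V}) : g v = v -> ~~ fpfree g.
  by move=> gv; rewrite negb_forall; apply/existsP; exists v; rewrite gv eqxx.
have {nfree} fixX (n : nat) : ~~ fpfree ((t * r ^+ i) ^+ n).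
  by apply: nfree; rewrite permX; elim: n => //= n ->.
(* Powers of the element still fix [v], so none of them may lie in a coset of fixed-point-free
   elements. *)
have cos (n : nat) : (t * r ^+ i) ^+ n \in T :* r ^+ (i * n).
  elim: n => [|n IHn]; first by rewrite muln0 !expg0 rcoset1.
  rewrite expgS mulnS expgD -rcoset_mul ?groupX //.
  by apply: mem_mulg => //; apply/rcosetP; exists t.
have free3 (n : nat) : (t * r ^+ i) ^+ n \notin T :* r ^+ 3.
  by apply: contra (fixX n) => /rcosetP[s sT ->]; exact: fpfree_half.
have free2 (n : nat) : (t * r ^+ i) ^+ n \notin T :* r ^+ 2.
  by apply: contra (fixX n) => /rcosetP[s sT ->]; exact: fpfree_third.
move: lt_i6 cos free2 free3 {fix_v fixX}.
(* The cube serves for [i = 1] and [i = 5], the square for [i = 4], the element itself for [i = 2]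
   and [i = 3]; modulo 6 the exponents 8 and 15 are 2 and 3. *)
case: i => [|[|[|[|[|[|//]]]]]] _ cos free2 free3.
- by rewrite mulg1.
- by case/negP: (free3 3); exact: (cos 3).
- by case/negP: (free2 1%N); exact: (cos 1%N).
- by case/negP: (free3 1%N); exact: (cos 1%N).
- by case/negP: (free2 2); rewrite -(r_mod6 2); exact: (cos 2).
- case/negP: (free3 3); rewrite -(r_mod6 3) -(r_mod6 (6 + 3)).
  exact: (cos 3).
Qed.

End TriangleGroup.

(** [f] factors through [g] on its image. Used in both directions, this equates the numbers of
    values of two maps with the same kernel. *)
Lemma leq_card_imset_kernel (T U W : finType) (f : T -> U) (g : T -> W) :
  (forall u v, g u = g v -> f u = f v) -> #|f @: T| <= #|g @: T|.
Proof.
move=> gf.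
(* Values are wrapped as singletons because [U] supplies no default element for a [w] outside the
   image of [g]. *)
pose h w := odflt set0 (omap (fun t => [set f t]) [pick t | g t == w]).
have hg t : h (g t) = [set f t].
  rewrite /h; case: pickP => [u /eqP/gf <- //|/(_ t)]; by rewrite eqxx.
rewrite -(card_imset _ (@set1_inj U)).
have -> : set1 @: (f @: T) = h @: (g @: T).
  by rewrite -!imset_comp; apply: eq_imset => t /=; rewrite hg.
exact: leq_imset_card.
Qed.

(** * Orbits of the centralizer of a transitive group *)

Section CentralizerOrbits.
Variables (V : finType) (P A : {group {perm V}}).
Hypothesis P_trans : forall u v, exists2 p : {perm V}, p \in P & p u = v.
Hypothesis A_cent : forall s : {perm V},
  reflect (forall p, p \in P -> forall v, s (p v) = p (s v)) (s \in A).

(** Elements of [A] commute with [P], hence preserve stabilizers. Conversely, if the stabilizers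
    agree, sending [p u] to [p v] is a well-defined permutation that commutes with [P]. *)
Lemma orbit_eq_stabilizer u v :
  (orbit 'P A u = orbit 'P A v) <-> ('C_P[u | 'P] = 'C_P[v | 'P]).
Proof.
have stabP p w : p \in P -> (p \in 'C_P[w | 'P]) = (p w == w).
  by move=> pP; rewrite inE pP; apply/astab1P/eqP.
split=> [/orbit_eqP/orbitP[s sA <-]|stab_uv].
  apply/setP=> p; have [pP|npP] := boolP (p \in P); last first.
    by rewrite !inE (negbTE npP).
  rewrite !stabP //= !apermE -(A_cent s sA) //.
  by rewrite (inj_eq perm_inj).
have [r rP] : exists r : V -> {perm V}, forall w, r w \in P /\ r w u = w.
  apply: (fin_all_exists (P := fun w p => p \in P /\ p u = w)) => w.
  by have [p] := P_trans u w; exists p.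
have rp w p : p \in P -> r (p w) v = p (r w v).
  move=> pP; have [[rwP rwu] [rpP rpu]] := (rP w, rP (p w)).
  (* Two elements of [P] that agree at [u] agree at [v], so the choice of [r] does not matter.
     Injectivity below uses the converse inclusion of stabilizers. *)
  have: r (p w) * (r w * p)^-1 \in 'C_P[u | 'P].
    have pwE : p w = (r w * p) u by rewrite permM rwu.
    by rewrite stabP ?groupM ?groupV ?groupM // permM rpu pwE permK.
  rewrite stab_uv stabP ?groupM ?groupV ?groupM // permM => /eqP e.
  by rewrite -[in RHS]e -permM permKV.
have inj : injective (fun w => r w v).
  move=> w w' /= e; have [[rwP rwu] [rpP rpu]] := (rP w, rP w').
  have: r w * (r w')^-1 \in 'C_P[v | 'P].
    by rewrite stabP ?groupM ?groupV // permM e permK.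
  rewrite -stab_uv stabP ?groupM ?groupV // permM rwu => /eqP e'.
  by rewrite -rpu -e' permKV.
apply/orbit_eqP; rewrite orbit_sym; apply/orbitP; exists (perm inj).
  by apply/A_cent=> p pP w; rewrite !permE rp.
rewrite /= apermE permE; have [ruP ruu] := rP u.
by apply/eqP; rewrite -stabP // -stab_uv stabP // ruu.
Qed.

(** By transitivity the point stabilizers form a single conjugacy class of subgroups of [P]. *)
Lemma card_orbit_centralizer v :
  #|[set orbit 'P A u | u : V]| = #|P : 'N_P('C_P[v | 'P])|.
Proof.
rewrite -card_conjugates.
have -> : 'C_P[v | 'P] :^: P = [set 'C_P[u | 'P] | u : V].
  have stabJ p : p \in P -> 'C_P[p v | 'P] = 'C_P[v | 'P] :^ p.
    move=> pP; rewrite -[p v]/('P%act v p) astab1_act.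
    by rewrite [RHS]conjIg (conjGid pP).
  apply/setP=> H; apply/imsetP/imsetP=> [[p pP ->]|[u _ ->]].
    by exists (p v) => //; rewrite stabJ.
  by have [p pP <-] := P_trans v u; exists p; rewrite ?stabJ.
by apply/eqP; rewrite eqn_leq !leq_card_imset_kernel // => u w
  /orbit_eq_stabilizer.
Qed.
End CentralizerOrbits.

Local Open Scope nat_scope.

(** * Polygons whose sides are alternately of two kinds *)

Section CyclicSequences.
Variable T : finType.
Implicit Types (p : seq T) (u w : T).

Lemma iter_next p u : uniq p -> u \in p -> iter (size p) (next p) u = u.
Proof.
move=> Up pu; rewrite -(order_cycle (cycle_next Up) Up pu).
exact: (iter_order_cycle (cycle_next Up)).
Qed.

Lemma iter_next_neq p u i : uniq p -> u \in p -> 0 < i < size p ->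
  iter i (next p) u != u.
Proof.
move=> Up pu /andP[i0 ip]; have := orbit_uniq (next p) u.
rewrite /fingraph.orbit (order_cycle (cycle_next Up) Up pu).
case: (size p) i i0 ip => // n [//|i] _ ip.
rewrite trajectS /= => /andP[un _]; apply: contraNneq un => e.
by apply/trajectP; exists i; rewrite -?iterSr ?e.
Qed.

Lemma next_prev_neq p u : uniq p -> 3 <= size p -> u \in p ->
  [/\ next p u != u, prev p u != u & next p u != prev p u].
Proof.
move=> Up sp pu.
have n1 : next p u != u.
  by apply: (@iter_next_neq p u 1) => //; exact: ltn_trans sp.
split=> //; apply: contra_neq (n1) => e; first by rewrite -{1}e next_prev.
by case/eqP: (@iter_next_neq p u 2 Up pu sp); rewrite /= e next_prev.
Qed.

(** Both directions are allowed at each vertex, so that the notion is insensitive to reversal of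
    [p]. *)
Definition alternates (n1 n2 : T -> T) p := forall w, w \in p ->
  (next p w = n1 w /\ prev p w = n2 w) \/ (next p w = n2 w /\ prev p w = n1 w).

Lemma alternatesC n1 n2 p : alternates n1 n2 p -> alternates n2 n1 p.
Proof. by move=> alt w /alt [|]; [right | left]. Qed.

(** The vertex [n1 u] is entered along a side of the first kind, so it is left along one of the
    second. *)
Lemma alternates_next n1 n2 p u :
  uniq p -> involutive n1 -> alternates n1 n2 p -> u \in p ->
  next p u = n1 u -> next p (n1 u) = n2 (n1 u).
Proof.
move=> Up n1K alt pu nu.
have: prev p (n1 u) = u by rewrite -nu prev_next.
have: n1 u \in p by rewrite -nu mem_next.
by case/alt=> [[-> ->] ->|[-> _ _]//]; rewrite n1K.
Qed.

Lemma alternates_iter n1 n2 p u i : uniq p -> involutive n1 -> involutive n2 ->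
  alternates n1 n2 p -> u \in p -> next p u = n1 u ->
  iter i (n2 \o n1) u = iter i.*2 (next p) u.
Proof.
move=> Up n1K n2K alt pu nu.
have alt' := alternatesC alt.
elim: i u pu nu => // i IHi u pu nu.
have nu2 := alternates_next Up n1K alt pu nu.
have nu1 : n1 u \in p by rewrite -nu mem_next.
rewrite doubleS 2![RHS]iterSr nu nu2 [LHS]iterSr; apply: IHi.
  by rewrite /= -nu2 mem_next.
exact: alternates_next Up n2K alt' nu1 nu2.
Qed.

Fixpoint walk (n1 n2 : T -> T) u k :=
  if k is k'.+1 then u :: walk n2 n1 (n1 u) k' else [::].

(** Such a polygon is determined by its length, the two maps and one vertex with the first step
    there. Comparing polygons thus reduces to comparing starting points. *)
Lemma alternates_walk n1 n2 p u : uniq p -> involutive n1 -> involutive n2 ->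
  alternates n1 n2 p -> u \in p -> next p u = n1 u ->
  exists i, rot i p = walk n1 n2 u (size p).
Proof.
move=> Up n1K n2K alt pu nu.
have [i q Eq] := rot_to pu; exists i.
have -> : rot i p = traject (next p) u (size p).
  have := @fcycle_consE _ (next p) u q; rewrite -Eq rot_cycle.
  by move=> /(_ (cycle_next Up)) ->; rewrite -(size_rot i p) Eq.
clear i q Eq.
elim: (size p) n1 n2 n1K n2K alt u pu nu => // k IHk n1 n2 n1K n2K alt u pu nu.
rewrite /= nu (IHk n2 n1) //; first exact: alternatesC.
  by rewrite -nu mem_next.
exact: alternates_next nu.
Qed.

Lemma map_walk (s m1 m2 : T -> T) n1 n2 u k :
  (forall w, s (n1 w) = m1 (s w)) -> (forall w, s (n2 w) = m2 (s w)) ->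
  map s (walk n1 n2 u k) = walk m1 m2 (s u) k.
Proof.
elim: k n1 n2 m1 m2 u => //= k IHk n1 n2 m1 m2 u e1 e2.
by rewrite (IHk _ _ m2 m1) ?e1.
Qed.

End CyclicSequences.

(** * Local structure of a map of this type *)

Section Type_4_6_12.
Variable X : face_complex.
Hypothesis X_map : is_polyhedral_map X.
Hypothesis X_type : semi_equivelar X [:: (4, 1); (6, 1); (12, 1)].
Implicit Types (u v w : vert X) (f g : face X) (k l m : nat).

Let U f : uniq (bd f) := bd_uniq X_map f.

Let face_cycle_at u : exists2 c, is_face_cycle u c &
  [seq size (bd f) | f <- c] = [:: 4; 6; 12] := X_type u.

Lemma face_at u k :
  k \in [:: 4; 6; 12] -> exists2 f, u \in bd f & size (bd f) = k.
Proof.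
have [c [_ _ _ cP] <-] := face_cycle_at u => /mapP[f fc ->].
by exists f; rewrite -?cP.
Qed.

Lemma size_bd f : size (bd f) \in [:: 4; 6; 12].
Proof.
have [u uf] : exists u, u \in bd f.
  by case: (bd f) (bd_size X_map f) => // u p; exists u; rewrite mem_head.
have [c [_ _ _ cP] <-] := face_cycle_at u.
by apply/mapP; exists f; rewrite ?cP.
Qed.

(** The sizes along a face-cycle, 4, 6 and 12, are distinct. *)
Lemma face_unique u f g :
  u \in bd f -> u \in bd g -> size (bd f) = size (bd g) -> f = g.
Proof.
have [c [_ _ _ cP] sc] := face_cycle_at u; rewrite -!cP => fc gc sfg.
have uc : uniq [seq size (bd f) | f <- c] by rewrite sc.
rewrite -(nth_index f fc) -(nth_index f gc); congr nth.
apply/eqP; rewrite -(nth_uniq 0 _ _ uc) ?size_map ?index_mem //.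
by rewrite !(nth_map f) ?index_mem // !nth_index // sfg.
Qed.

Lemma face_edge_verts f v w :
  [set v; w] \in face_edges f -> v \in bd f /\ w \in bd f.
Proof.
case/imsetP=> z zf /setP e.
have := e v; have := e w; rewrite !inE !eqxx /= orbT => /esym ew /esym ev.
by split; [case/orP: ev | case/orP: ew] => /eqP ->; rewrite ?mem_next.
Qed.

(** Two distinct faces have at most two vertices in common. *)
Lemma meet_unique f g u v w : f != g -> u \in bd f -> u \in bd g ->
  v \in bd f -> v \in bd g -> w \in bd f -> w \in bd g ->
  v != u -> w != u -> v = w.
Proof.
move=> fg uf ug vf vg wf wg vu wu; apply/eqP; apply: contraT => vw.
have I3 : 2 < #|face_verts f :&: face_verts g|.
  apply: leq_trans (subset_leq_card (_ : u |: [set v; w] \subset _)).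
    by rewrite cardsU1 cards2 vw !inE negb_or ![u == _]eq_sym vu wu.
  by apply/subsetP=> z; rewrite !inE => /or3P[] /eqP->; rewrite ?uf ?vf ?wf.
case: (faces_meet X_map fg) I3 => [->|[z ->]|[e /setIP[/imsetP[z _ ->] _] ->]].
- by rewrite cards0.
- by rewrite cards1.
- by rewrite cards2; case: (_ != _).
Qed.

Lemma face_across f u v : [set u; v] \in face_edges f ->
  exists g, [/\ g != f, u \in bd g & v \in bd g].
Proof.
move=> ef; have eE : [set u; v] \in edges X by apply/bigcupP; exists f.
have := edge_two_faces X_map eE.
move=> /eqP/cards2P[g [h [gh]]].
move=> defE.
have on_e (k : face X) : k \in [set g; h] -> u \in bd k /\ v \in bd k.
  by rewrite -defE inE => /face_edge_verts.
have [[ug vg] [uh vh]] := (on_e g (set21 g h), on_e h (set22 g h)).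
have [gf|gf] := eqVneq g f; last by exists g.
by exists h; rewrite uh vh -gf eq_sym gh.
Qed.

(** Lets [k], [l], [m] stand for 4, 6, 12 in any order, so that each argument is given once for all
    three kinds of face. *)
Definition sizes k l m := perm_eq [:: k; l; m] [:: 4; 6; 12].

Lemma neighbour_faces k l m f u :
  sizes k l m -> u \in bd f -> size (bd f) = k ->
  exists g h, [/\ size (bd g) = l, size (bd h) = m, u \in bd g, u \in bd h &
    (next (bd f) u \in bd g /\ prev (bd f) u \in bd h) \/
    (next (bd f) u \in bd h /\ prev (bd f) u \in bd g)].
Proof.
move=> klm uf sf.
have [nu pu np] := next_prev_neq (U f) (bd_size X_map f) uf.
have pf : prev (bd f) u \in bd f by rewrite mem_prev.
have nf : next (bd f) u \in bd f by rewrite mem_next.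
have [g [gf ug ng]] : exists g,
  [/\ g != f, u \in bd g & next (bd f) u \in bd g].
  by apply: face_across; apply/imsetP; exists u; rewrite ?inE.
have [h [hf ph uh]] : exists h,
  [/\ h != f, prev (bd f) u \in bd h & u \in bd h].
  apply: face_across; apply/imsetP; exists (prev (bd f) u);
    by rewrite ?inE ?next_prev.
(* Neighbours of equal size would be one face, sharing with [f] the vertex [u] and both its
   neighbours on [f]. *)
have gh : size (bd g) != size (bd h).
  apply: contra_neq np => sgh; have ghE := face_unique ug uh sgh.
  by apply: (@meet_unique f h u); rewrite // 1?eq_sym // -ghE.
have other i : i != f -> u \in bd i -> size (bd i) = l \/ size (bd i) = m.
  move=> fi ui; have := size_bd i; rewrite -(perm_mem klm) !inE -sf.
  case/or3P=> /eqP; auto=> e.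
  by rewrite (face_unique ui uf e) eqxx in fi.
case: (other g gf ug) (other h hf uh) gh => [gl|gm] [hl|hm].
- by rewrite gl hl eqxx.
- by exists g, h; split=> //; left.
- by exists h, g; split=> //; right.
- by rewrite gm hm eqxx.
Qed.

(* The other end of the edge at [u] between its [k]-gon and its [l]-gon. *)
Definition across k l u : vert X :=
  odflt u [pick v | (v != u) && [exists f, exists g,
    [&& size (bd f) == k, size (bd g) == l,
        u \in bd f, u \in bd g, v \in bd f & v \in bd g]]].

Lemma acrossC k l u : across k l u = across l k u.
Proof.
rewrite /across; congr odflt; apply: eq_pick => v; congr andb.
by apply/existsP/existsP=> [] [f /existsP[g /and5P[? ? ? ? /andP[? ?]]]];
   exists g; apply/existsP; exists f; apply/and5P; split=> //; apply/andP.
Qed.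

Lemma acrossE k l f g u v : k != l -> size (bd f) = k -> size (bd g) = l ->
  u \in bd f -> u \in bd g -> v \in bd f -> v \in bd g -> v != u ->
  across k l u = v.
Proof.
move=> kl sf sg uf ug vf vg vu; rewrite /across; case: pickP => [w|/(_ v)].
  case/andP=> wu /existsP[f' /existsP[g']].
  case/and5P=> /eqP sf' /eqP sg' uf' ug' /andP[wf wg] /=.
  have ef : f' = f by apply: (face_unique uf'); rewrite // sf'.
  have eg : g' = g by apply: (face_unique ug'); rewrite // sg'.
  subst f' g'; apply: (@meet_unique f g u) => //.
  by apply: contra_neq kl => e; rewrite -sf -sg e.
rewrite vu /= => /existsP[]; exists f; apply/existsP; exists g.
by rewrite sf sg !eqxx uf ug vf vg.
Qed.

Lemma sizes_neq k l m : sizes k l m -> k != l.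
Proof.
by move/perm_uniq => /=; rewrite !inE negb_or; case: (k == l).
Qed.
Lemma sizesC k l m : sizes k l m -> sizes k m l.
Proof. by apply: perm_trans; rewrite perm_cons (perm_catC [:: m]). Qed.

Lemma across_alternates k l m f : sizes k l m -> size (bd f) = k ->
  alternates (across k l) (across k m) (bd f).
Proof.
move=> klm sf u uf.
have [nu pu np] := next_prev_neq (U f) (bd_size X_map f) uf.
have pf : prev (bd f) u \in bd f by rewrite mem_prev.
have nf : next (bd f) u \in bd f by rewrite mem_next.
have kl := sizes_neq klm; have km := sizes_neq (sizesC klm).
have [g [h [sg sh ug uh]]] := neighbour_faces klm uf sf.
case=> [[ng ph]|[nh pg]]; [left | right]; split; symmetry.
- exact: (acrossE kl sf sg).
- exact: (acrossE km sf sh).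
- exact: (acrossE km sf sh).
- exact: (acrossE kl sf sg).
Qed.

(** In particular the search in [across] succeeds, and its default [u] is not returned. *)
Lemma across_spec k l m u : sizes k l m ->
  exists f g, [/\ size (bd f) = k, size (bd g) = l, u \in bd f, u \in bd g &
   [/\ across k l u \in bd f, across k l u \in bd g & across k l u != u]].
Proof.
move=> klm; have ks : k \in [:: 4; 6; 12] by rewrite -(perm_mem klm) mem_head.
have [f uf sf] := face_at u ks.
have kl := sizes_neq klm.
have [nu pu np] := next_prev_neq (U f) (bd_size X_map f) uf.
have pf : prev (bd f) u \in bd f by rewrite mem_prev.
have nf : next (bd f) u \in bd f by rewrite mem_next.
have [g [h [sg sh ug uh]]] := neighbour_faces klm uf sf.
case=> [[ng _]|[_ pg]]; exists f, g; split=> //.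
  by rewrite (acrossE kl sf sg uf ug nf ng).
by rewrite (acrossE kl sf sg uf ug pf pg).
Qed.

Lemma across_mem k l m u f :
  sizes k l m -> size (bd f) = k -> u \in bd f -> across k l u \in bd f.
Proof.
move=> klm sf uf; have [f' [g [sf' sg uf' ug [af _ _]]]] := across_spec u klm.
by rewrite -(face_unique uf' uf) // sf'.
Qed.

Lemma acrossK k l m : sizes k l m -> involutive (across k l).
Proof.
move=> klm u; have [f [g [sf sg uf ug [af ag au]]]] := across_spec u klm.
by apply: (acrossE (sizes_neq klm) sf sg) => //; rewrite eq_sym.
Qed.

Lemma face_cycle_from k l m f u :
  sizes k l m -> size (bd f) = k -> u \in bd f ->
  exists2 p, (p = bd f \/ p = rev (bd f)) &
    [/\ uniq p, u \in p, size p = k, alternates (across k l) (across k m) p &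
        next p u = across k l u].
Proof.
move=> klm sf uf; have alt := across_alternates klm sf.
have [[nu _]|[nu pu]] := alt u uf; first by exists (bd f); [left | split].
exists (rev (bd f)); first by right.
rewrite rev_uniq mem_rev size_rev next_rev //; split=> // w.
by rewrite mem_rev next_rev // prev_rev // => /alt [][-> ->]; [right | left].
Qed.

(** Each iteration advances by two sides along the [k]-gon at [u]. This is the source of the three
    relations, and [across_iter_neq] that of the absence of fixed points. *)
Lemma across_iter k l m u i : sizes k l m -> i.*2 = k ->
  iter i (across k m \o across k l) u = u.
Proof.
move=> klm ik; have klm' := sizesC klm.
have ks : k \in [:: 4; 6; 12] by rewrite -(perm_mem klm) mem_head.
have [f uf sf] := face_at u ks.
have [p _ [Up pu sp alt nu]] := face_cycle_from klm sf uf.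
rewrite (alternates_iter _ Up (acrossK klm) (acrossK klm') alt) // ik -sp.
exact: iter_next.
Qed.

Lemma across_iter_neq k l m u i : sizes k l m -> 0 < i.*2 < k ->
  iter i (across k m \o across k l) u != u.
Proof.
move=> klm ik; have klm' := sizesC klm.
have ks : k \in [:: 4; 6; 12] by rewrite -(perm_mem klm) mem_head.
have [f uf sf] := face_at u ks.
have [p _ [Up pu sp alt nu]] := face_cycle_from klm sf uf.
rewrite (alternates_iter _ Up (acrossK klm) (acrossK klm') alt) //.
by apply: iter_next_neq; rewrite ?sp.
Qed.

(** The proof [klm] is an argument because the injectivity of [across k l] rests on it. *)
Definition cross k l m (klm : sizes k l m) : {perm vert X} :=
  perm (inv_inj (acrossK klm)).

Lemma crossE k l m (klm : sizes k l m) u : cross klm u = across k l u.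
Proof. exact: permE. Qed.

Lemma crossK k l m (klm : sizes k l m) : (cross klm * cross klm = 1)%g.
Proof. by apply/permP=> u; rewrite permM perm1 !crossE (acrossK klm). Qed.

Lemma crossX k l m (klm : sizes k l m) (kml : sizes k m l) i u :
  ((cross klm * cross kml) ^+ i)%g u = iter i (across k m \o across k l) u.
Proof. by rewrite permX; apply: eq_iter => v /=; rewrite permM !crossE. Qed.

(** * The generators, their relations and transitivity *)

Let s4_12 : sizes 4 12 6 := isT.
Let s4_6 : sizes 4 6 12 := isT.
Let s6_12 : sizes 6 12 4 := isT.
Let s6_4 : sizes 6 4 12 := isT.
Let s12_4 : sizes 12 4 6 := isT.
Let s12_6 : sizes 12 6 4 := isT.

Let a := cross s4_12.
Let b := cross s4_6.
Let c := cross s6_12.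
Let P : {group {perm vert X}} := triangle_group a b c.

(** An edge may be seen from either of its faces; a relation around a [k]-gon needs both generators
    seen from that [k]-gon. *)
Let aE : a = cross s12_4.
Proof. by apply/permP=> u; rewrite !crossE acrossC. Qed.
Let bE : b = cross s6_4.
Proof. by apply/permP=> u; rewrite !crossE acrossC. Qed.
Let cE : c = cross s12_6.
Proof. by apply/permP=> u; rewrite !crossE acrossC. Qed.

Let ab2 : ((a * b) ^+ 2 = 1)%g.
Proof. by apply/permP=> u; rewrite perm1 crossX (@across_iter 4 12 6). Qed.
Let bc3 : ((b * c) ^+ 3 = 1)%g.
Proof. by apply/permP=> u; rewrite bE perm1 crossX (@across_iter 6 4 12). Qed.
Let ac6 : ((a * c) ^+ 6 = 1)%g.
Proof.
by apply/permP=> u; rewrite aE cE perm1 crossX (@across_iter 12 4 6).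
Qed.
Let ab_free : fpfree (a * b)%g.
Proof.
by apply/forallP=> u;
  rewrite -(expg1 (a * b)%g) crossX (@across_iter_neq 4 12 6).
Qed.
Let bc_free : fpfree (b * c)%g.
Proof.
by apply/forallP=> u;
  rewrite bE -(expg1 (_ * _)%g) crossX (@across_iter_neq 6 4 12).
Qed.
Let acX_free i : 0 < i.*2 < 12 -> fpfree ((a * c) ^+ i)%g.
Proof.
by move=> i6; apply/forallP=> u;
  rewrite aE cE crossX (@across_iter_neq 12 4 6).
Qed.

Let across_P k l m : sizes k l m -> exists2 p, p \in P & p =1 across k l.
Proof.
move=> klm; have kl := sizes_neq klm.
have [aP bP cP] : [/\ a \in P, b \in P & c \in P].
  by split; rewrite mem_gen // !inE eqxx ?orbT.
have : l \in [:: 4; 6; 12] by rewrite -(perm_mem klm) !inE eqxx orbT.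
have : k \in [:: 4; 6; 12] by rewrite -(perm_mem klm) !inE eqxx.
rewrite !inE => /or3P[]/eqP ek /or3P[]/eqP el; subst k l => //.
- by exists b => // u; rewrite crossE.
- by exists a => // u; rewrite crossE.
- by exists b => // u; rewrite crossE acrossC.
- by exists c => // u; rewrite crossE.
- by exists a => // u; rewrite crossE acrossC.
- by exists c => // u; rewrite crossE acrossC.
Qed.

Lemma sizes_of f : exists l m, sizes (size (bd f)) l m.
Proof.
have := size_bd f; rewrite !inE => /or3P[]/eqP ->.
- by exists 6, 12.
- by exists 4, 12.
- by exists 4, 6.
Qed.

(** Every edge is a side of a face, along which each step is some [across]; the rest is
    connectedness. *)
Let P_trans u v : exists2 p : {perm vert X}, p \in P & p u = v.
Proof.
have /connectP[q] := vert_connected X_map u v.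
elim: q u => [|w q IHq] u /= => [_ ->|/andP[uw pq] ev].
  by exists 1%g; rewrite ?group1 ?perm1.
have [p pP <-] := IHq _ pq ev.
suff [p' pP' <-] : exists2 p : {perm vert X}, p \in P & p u = w.
  by exists (p' * p)%g; rewrite ?groupM ?permM.
case/bigcupP: uw => f _ uwf; have [uf wf] := face_edge_verts uwf.
have [l [m klm]] := sizes_of f.
have [p1 p1P p1E] := across_P klm; have [p2 p2P p2E] := across_P (sizesC klm).
have {uwf} [->|[wE|wE]] : w = u \/ w = next (bd f) u \/ w = prev (bd f) u.
  case/imsetP: uwf => z zf /setP e.
  have := e u; have := e w; rewrite !inE !eqxx /= orbT.
  move=> /esym/orP[]/eqP-> /esym/orP[]/eqP->; rewrite ?(prev_next (U f)); auto.
- by exists 1%g; rewrite ?group1 ?perm1.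
- rewrite wE; case: (across_alternates klm (erefl _) uf) => [][-> _].
    by exists p1.
  by exists p2.
- rewrite wE; case: (across_alternates klm (erefl _) uf) => [][_ ->].
    by exists p2.
  by exists p1.
Qed.

(** * Automorphisms as the centralizer of the generated group *)

Lemma same_polygon_sym (s t : seq (vert X)) :
  same_polygon s t -> same_polygon t s.
Proof.
case/same_polygonP=> i [] ->; apply/same_polygonP.
  by exists (size (rot i s) - i); left; rewrite -[RHS]/(rotr i (rot i s)) rotK.
by exists i; right; rewrite -rev_rotr rotK revK.
Qed.

Let poly_walk k l m f u : sizes k l m -> size (bd f) = k -> u \in bd f ->
  same_polygon (bd f) (walk (across k l) (across k m) u k).
Proof.
move=> klm sf uf; have [p pE [Up pu sp alt nu]] := face_cycle_from klm sf uf.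
have [i e] := alternates_walk Up (acrossK klm) (acrossK (sizesC klm)) alt pu nu.
rewrite sp in e; rewrite -e; apply/same_polygonP; exists i.
by case: pE => ->; [left | right].
Qed.

(** Automorphisms preserve incidence and face sizes, which determine [across]. *)
Let Aut_across s k l m u : s \in Aut_map X -> sizes k l m ->
  s (across k l u) = across k l (s u).
Proof.
rewrite inE => /forallP sA klm.
have img f : exists2 f', size (bd f') = size (bd f) &
    forall w, w \in bd f -> s w \in bd f'.
  have /existsP[f' /same_polygonP[i e]] := sA f; exists f'.
    by case: e => ->; rewrite size_rot ?size_rev size_map.
  by move=> w wf; case: e => ->; rewrite mem_rot ?mem_rev map_f.
have [f [g [sf sg uf ug [af ag au]]]] := across_spec u klm.
have [f' sf' ff'] := img f; have [g' sg' gg'] := img g.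
symmetry; apply: (@acrossE k l f' g'); rewrite ?sf' ?sg' ?ff' ?gg' //.
  exact: sizes_neq klm.
by rewrite (inj_eq perm_inj).
Qed.

Let Aut_cent (s : {perm vert X}) :
  reflect (forall p, p \in P -> forall v, s (p v) = p (s v)) (s \in Aut_map X).
Proof.
apply: (iffP idP) => [sA p pP v|scP].
  suff sp : p \in 'C[s]%g by rewrite -!permM (cent1P sp).
  apply: (subsetP _ p pP); rewrite gen_subG; apply/subsetP=> g gabc.
  apply/cent1P/permP=> u; move: gabc; rewrite !inE -orbA.
  case/or3P=> /eqP->; rewrite !permM !crossE.
  - exact: Aut_across u sA s4_12.
  - exact: Aut_across u sA s4_6.
  - exact: Aut_across u sA s6_12.
(* Conversely, [s] carries the alternating walk around [f] from [u] to the one from [s u], which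
   bounds the face of the same size there. *)
rewrite inE; apply/forallP=> f; apply/existsP.
have [u uf] : exists u, u \in bd f.
  by case: (bd f) (bd_size X_map f) => // u p; exists u; rewrite mem_head.
have [f' uf' sf'] := face_at (s u) (size_bd f); exists f'.
have [l [m klm]] := sizes_of f; have kml := sizesC klm.
apply: same_polygon_trans (same_polygon_map s (poly_walk klm (erefl _) uf)) _.
have com k' l' m' : sizes k' l' m' ->
  forall w, s (across k' l' w) = across k' l' (s w).
  by move=> klm' w; have [p pP pE] := across_P klm'; rewrite -!pE scP.
rewrite (map_walk _ _ (com _ _ _ klm) (com _ _ _ kml)).
exact: same_polygon_sym (poly_walk klm sf' uf').
Qed.

(** * The two-colouring of the vertices given by an orientation *)

Section Orientation.
Variable o : face X -> bool.
Hypothesis o_orients : forall f g v, v \in bd f -> v \in bd g ->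
  next (oriented_bd o f) v = next (oriented_bd o g) v -> f = g.

(* The orientation leads out of [u] along the edge of its [k]-gon with its
   [l]-gon; at an edge it does so in exactly one of the two faces. *)
Definition forward k l u := [exists f,
  [&& u \in bd f, size (bd f) == k & next (oriented_bd o f) u == across k l u]].

Lemma forwardE k l f u : u \in bd f -> size (bd f) = k ->
  forward k l u = (next (oriented_bd o f) u == across k l u).
Proof.
move=> uf sf; apply/existsP/idP => [[g /and3P[ug /eqP sg]]|e].
  by rewrite (face_unique ug uf) // sg.
by exists f; rewrite uf sf eqxx.
Qed.

Lemma oriented_alternates k l m f : sizes k l m -> size (bd f) = k ->
  alternates (across k l) (across k m) (oriented_bd o f).
Proof.
move=> klm sf; have alt := across_alternates klm sf; rewrite /oriented_bd.
case: (o f) => // w.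
by rewrite mem_rev next_rev ?prev_rev ?U // => /alt [][-> ->]; [right | left].
Qed.

Lemma oriented_uniq f : uniq (oriented_bd o f).
Proof. by rewrite /oriented_bd; case: (o f); rewrite ?rev_uniq U. Qed.

Lemma mem_oriented f u : (u \in oriented_bd o f) = (u \in bd f).
Proof. by rewrite /oriented_bd; case: (o f); rewrite ?mem_rev. Qed.

Lemma size_oriented f : 3 <= size (oriented_bd o f).
Proof.
by rewrite /oriented_bd; case: (o f); rewrite ?size_rev (bd_size X_map).
Qed.

(** An oriented boundary leaves [u] along exactly one of its two sides there. *)
Lemma forward_other k l m u : sizes k l m -> forward k m u = ~~ forward k l u.
Proof.
move=> klm; have ks : k \in [:: 4; 6; 12] by rewrite -(perm_mem klm) mem_head.
have [f uf sf] := face_at u ks; rewrite !(forwardE _ uf sf).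
have uo : u \in oriented_bd o f by rewrite mem_oriented.
have [_ _ np] := next_prev_neq (oriented_uniq f) (size_oriented f) uo.
case: (oriented_alternates klm sf uo) np => [][-> ->] /negbTE n.
  by rewrite eqxx n.
by rewrite eqxx n.
Qed.

(** An oriented boundary traverses a side from only one of its ends. *)
Lemma forward_across k l m u : sizes k l m ->
  forward k l (across k l u) = ~~ forward k l u.
Proof.
move=> klm; have ks : k \in [:: 4; 6; 12] by rewrite -(perm_mem klm) mem_head.
have K := acrossK klm.
have [f uf sf] := face_at u ks; have alt := oriented_alternates klm sf.
have uo : u \in oriented_bd o f by rewrite mem_oriented.
have ao : across k l u \in bd f := across_mem klm sf uf.
have [_ _ np] := next_prev_neq (oriented_uniq f) (size_oriented f) uo.
rewrite (forwardE _ uf sf); case: (alt u uo) => [][nu pu].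
  rewrite nu eqxx /=; apply: negbTE; rewrite -(forward_other _ klm).
  rewrite (forwardE _ ao sf); apply/eqP.
  exact: (alternates_next (oriented_uniq f) K alt).
by rewrite (forwardE _ ao sf) K -pu next_prev ?oriented_uniq // eqxx np.
Qed.

Lemma forward_flip k l m m' u : sizes k l m -> sizes l k m' ->
  forward k l u -> ~~ forward l k u.
Proof.
move=> klm lkm.
have ks : k \in [:: 4; 6; 12] by rewrite -(perm_mem klm) mem_head.
have ls : l \in [:: 4; 6; 12] by rewrite -(perm_mem lkm) mem_head.
have [f uf sf] := face_at u ks; have [g ug sg] := face_at u ls.
rewrite (forwardE _ uf sf) (forwardE _ ug sg) acrossC => /eqP e.
apply: contra (sizes_neq klm) => /eqP e'.
by rewrite -sf -sg (o_orients uf ug) // e e'.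
Qed.

Let forward_b u : forward 4 12 u = ~~ forward 4 6 u.
Proof. exact: (forward_other u s4_6). Qed.

(** Since [forward_flip] is only an implication, the converse is obtained by going on around [u],
    through the hexagon and back to the square. *)
Let forward_c u : forward 4 12 u = forward 12 6 u.
Proof.
apply/idP/idP.
  by move/(forward_flip s4_12 s12_4); rewrite (forward_other u s12_6) negbK.
move/(forward_flip s12_6 s6_12); rewrite (forward_other u s6_4) negbK.
by move/(forward_flip s6_4 s4_6); rewrite forward_b.
Qed.

Lemma orbits_dvd12_oriented :
  #|[set orbit 'P (Aut_map X) u | u : vert X]| %| 12.
Proof.
have /card_gt0P[v _] := vert_nonempty X_map.
have a2 : (a * a = 1)%g := crossK _.
have b2 : (b * b = 1)%g := crossK _.
have c2 : (c * c = 1)%g := crossK _.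
(* The colour [forward 4 12] changes along every edge: for [b] and [c] it is first expressed through
   the edge being crossed. *)
have fa u : forward 4 12 (a u) = ~~ forward 4 12 u.
  by rewrite crossE (forward_across _ s4_12).
have fb u : forward 4 12 (b u) = ~~ forward 4 12 u.
  by rewrite !forward_b crossE (forward_across _ s4_6).
have fc u : forward 4 12 (c u) = ~~ forward 4 12 u.
  by rewrite !forward_c cE crossE (forward_across _ s12_6).
have stabT : ('C_P[v | 'P] \subset translations a b c)%g.
  exact: (stabilizer_translations a2 b2 c2 ab2 bc3 ac6 ab_free bc_free
            (acX_free (i := 2) isT) (acX_free (i := 3) isT) fa fb fc).
rewrite (card_orbit_centralizer (A := Aut_map_group X) P_trans Aut_cent v).
apply: dvdn_trans (index_translations a2 b2 c2 ab2 bc3 ac6); apply: indexgS.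
rewrite subsetI (translations_sub a2 b2 c2 ab2 bc3 ac6) /=.
have cT := translations_abelian a2 b2 ab2 bc3 ac6.
exact: subset_trans (subset_trans cT (centS stabT)) (cent_sub _).
Qed.

End Orientation.

Lemma orbits_dvd12 :
  orientable X -> #|[set orbit 'P (Aut_map X) u | u : vert X]| %| 12.
Proof. by case=> o; exact: orbits_dvd12_oriented. Qed.

End Type_4_6_12.

Theorem theorem1 :
  ~ exists X : polyhedral_map,
      [/\ toroidal X,
          semi_equivelar X [:: (4, 1); (6, 1); (12, 1)] &
          m_orbital X 5].
Proof.
case=> X [[oX _] tX orbX].
by have := orbits_dvd12 (polyhedral_mapP X) tX oX; rewrite orbX.
Qed.
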